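(* Let $n=2^k+r$ with integers $k\ge 0$ and $0\le r<2^k$. The Hamming weight $s_1(n)$ of $n$ satisfies $$s_1(n)=2^{k-1}\left(\tau\left(\frac{r}{2^k}\right)-\tau\left(\frac{r+1}{2^k}\right)\right)+\frac{k+2}{2}.$$
   Context: The Hamming weight $s_1(n)$ is the number of $1$s in the binary expansion of $n$. $\tau$ denotes the Takagi function on $[0,1]$, a continuous function. On dyadic rationals it is given as follows: for integers $k\ge 0$ and $0\le N<2^{k+1}$ with binary digits $N=\sum_{i=0}^{k}N_i2^i$, $N_i\in\{0,1\}$, and $N_i=0$ for every negative integer $i$, $\tau\left(\frac{N}{2^{k+1}}\right)=\sum_{i=1}^\infty \frac{\ell_i(N)}{2^i}$, where for $i\ge 0$, $\ell_{i+1}(N)=\sum_{j=0}^{i-1}N_{k-j}$ if $N_{k-i}=0$, and $\ell_{i+1}(N)=i-\sum_{j=0}^{i-1}N_{k-j}$ if $N_{k-i}=1$. Also $\tau(1)=0$. (Equivalently, $\tau(x)=\sum_{m=0}^\infty 2^{-m}\,\mathrm{dist}(2^m x,\mathbb{Z})$ for $x\in[0,1]$.) *)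

(* Defs.v *)
From Stdlib Require Import Reals Lra Lia ZArith Arith List.
From Coquelicot Require Import Coquelicot.

Open Scope R_scope.

(* Bits of index at least [n] vanish, since [n < 2 ^ n]. *)
Definition hamming_weight (n : nat) : nat :=
  length (filter (Nat.testbit n) (seq 0 n)).

(* The coefficient of [2 ^ - j], for [j >= 1], in the binary expansion of the
   fractional part of [x]; a dyadic rational gets its terminating expansion,
   and [1] gets the digits of [0]. *)
Definition binary_digit (x : R) (j : nat) : Z :=
  (Int_part (2 ^ j * x) mod 2)%Z.

(* [takagi_ell x i] is l_(i+1), the number of digits among the first [i]
   that differ from digit [i + 1]. *)
Definition takagi_ell (x : R) (i : nat) : R :=
  let s := sum_n_m (fun j => IZR (binary_digit x j)) 1 i in
  if (binary_digit x (S i) =? 0)%Z then s else INR i - s.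

(* Only the values on [0, 1] are meant; elsewhere this is the extension of
   period 1. *)
Definition takagi (x : R) : R :=
  Series (fun i => takagi_ell x i / 2 ^ (S i)).

(* The three lemmas [takagi_dyadic], [takagi_1] and [takagi_dist] check
   [takagi] against the usual descriptions of the Takagi function.
   [takagi_dyadic] restates the definition with the binary digits of [N]
   itself; it needs no bound on [N] because [takagi] has period 1. *)

(* The binary digit of [N] of index [m], with [0] for negative [m]. *)
Definition nat_digit (N : nat) (m : Z) : Z := Z.b2z (Z.testbit (Z.of_nat N) m).

Definition dyadic_ell (k N i : nat) : R :=
  let s := sum_n_m (fun j => IZR (nat_digit N (Z.of_nat k - Z.of_nat j + 1))) 1 i in
  if (nat_digit N (Z.of_nat k - Z.of_nat i) =? 0)%Z then s else INR i - s.

Lemma Int_part_unique (x : R) (z : Z) : IZR z <= x < IZR z + 1 -> Int_part x = z.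
Proof.
  intros H. destruct (base_Int_part x) as [H1 H2].
  assert (A : IZR (Int_part x) < IZR (z + 1)) by (rewrite plus_IZR; lra).
  assert (B : IZR z < IZR (Int_part x + 1)) by (rewrite plus_IZR; lra).
  apply lt_IZR in A. apply lt_IZR in B. lia.
Qed.

Lemma Int_part_div (a b : Z) : (0 < b)%Z -> Int_part (IZR a / IZR b) = (a / b)%Z.
Proof.
  intros Hb. apply Int_part_unique.
  assert (Hb' : 0 < IZR b) by (apply IZR_lt; lia).
  pose proof (Z.div_mod a b ltac:(lia)) as E.
  pose proof (Z.mod_pos_bound a b Hb) as [M1 M2].
  apply IZR_le in M1. apply IZR_lt in M2.
  assert (E' : IZR a = IZR b * IZR (a / b) + IZR (a mod b))
    by (rewrite <- mult_IZR, <- plus_IZR; now f_equal).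
  split.
  - apply Rmult_le_reg_r with (IZR b); [lra|]. unfold Rdiv.
    rewrite (Rmult_assoc (IZR a)), Rinv_l; lra.
  - apply Rmult_lt_reg_r with (IZR b); [lra|]. unfold Rdiv at 1.
    rewrite (Rmult_assoc (IZR a)), Rinv_l; lra.
Qed.

Lemma binary_digit_dyadic (k N j : nat) :
  binary_digit (INR N / 2 ^ (k + 1)) j = nat_digit N (Z.of_nat k - Z.of_nat j + 1).
Proof.
  unfold binary_digit, nat_digit. rewrite INR_IZR_INZ.
  destruct (Nat.le_gt_cases j (k + 1)) as [H | H].
  - replace (2 ^ j * (IZR (Z.of_nat N) / 2 ^ (k + 1)))
      with (IZR (Z.of_nat N) / IZR (2 ^ Z.of_nat (k + 1 - j))).
    + rewrite Int_part_div by (apply Z.pow_pos_nonneg; lia).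
      rewrite Z.testbit_spec' by lia. do 3 f_equal. lia.
    + rewrite <- pow_IZR. replace (k + 1)%nat with (j + (k + 1 - j))%nat at 2 by lia.
      rewrite pow_add. field; repeat split; apply pow_nonzero; lra.
  - replace (2 ^ j * (IZR (Z.of_nat N) / 2 ^ (k + 1)))
      with (IZR (2 * (2 ^ Z.of_nat (j - (k + 2)) * Z.of_nat N))).
    + replace (Int_part _) with (2 * (2 ^ Z.of_nat (j - (k + 2)) * Z.of_nat N))%Z
        by (symmetry; apply Int_part_unique; lra).
      rewrite Z.mul_comm, Z.mod_mul by lia.
      rewrite Z.testbit_neg_r by lia. reflexivity.
    + rewrite !mult_IZR, <- pow_IZR.
      replace j with (1 + (k + 1) + (j - (k + 2)))%nat at 2 by lia.
      rewrite !pow_add. field; repeat split; apply pow_nonzero; lra.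
Qed.

Lemma takagi_dyadic (k N : nat) :
  takagi (INR N / 2 ^ (k + 1)) = Series (fun i => dyadic_ell k N i / 2 ^ (S i)).
Proof.
  apply Series_ext. intros i. unfold takagi_ell, dyadic_ell.
  rewrite binary_digit_dyadic.
  replace (Z.of_nat k - Z.of_nat (S i) + 1)%Z with (Z.of_nat k - Z.of_nat i)%Z by lia.
  rewrite (sum_n_m_ext _ (fun j => IZR (nat_digit N (Z.of_nat k - Z.of_nat j + 1))));
    [reflexivity | intros j; now rewrite binary_digit_dyadic].
Qed.

Lemma binary_digit_1 (j : nat) : (1 <= j)%nat -> binary_digit 1 j = 0%Z.
Proof.
  intros H. unfold binary_digit. rewrite Rmult_1_r, pow_IZR.
  replace (Int_part _) with (2 ^ Z.of_nat j)%Z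
    by (symmetry; apply Int_part_unique; lra).
  replace (Z.of_nat j) with (Z.of_nat (j - 1) + 1)%Z by lia.
  rewrite Z.pow_add_r by lia. apply Z.mod_mul. lia.
Qed.

Lemma Series_zero : Series (fun _ => 0) = 0.
Proof.
  transitivity (0 * Series (fun _ => 0)); [|ring]. rewrite <- Series_scal_l.
  apply Series_ext. intros i. ring.
Qed.

Lemma takagi_1 : takagi 1 = 0.
Proof.
  rewrite <- Series_zero. apply Series_ext. intros i.
  unfold takagi_ell. rewrite binary_digit_1 by lia. simpl Z.eqb. cbv iota zeta.
  rewrite (sum_n_m_ext_loc _ (fun _ => 0)).
  - replace (sum_n_m (fun _ => 0) 1 i) with 0; [unfold Rdiv; ring|].
    symmetry. apply (sum_n_m_const_zero (G := R_AbelianMonoid)).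
  - intros j Hj. now rewrite binary_digit_1.
Qed.

Definition dist_int (x : R) : R := Rmin (frac_part x) (1 - frac_part x).

Lemma frac_part_bound (x : R) : 0 <= frac_part x < 1.
Proof. destruct (base_fp x). lra. Qed.

Lemma dist_int_bound (x : R) : 0 <= dist_int x <= 1.
Proof.
  pose proof (frac_part_bound x). unfold dist_int.
  apply (Rmin_case (frac_part x) (1 - frac_part x) (fun y => 0 <= y <= 1)); lra.
Qed.

Lemma binary_digit_01 (x : R) (j : nat) :
  binary_digit x j = 0%Z \/ binary_digit x j = 1%Z.
Proof. unfold binary_digit. pose proof (Z.mod_pos_bound (Int_part (2 ^ j * x)) 2). lia. Qed.

Lemma binary_digit_double (x : R) (j : nat) :
  binary_digit (2 * x) j = binary_digit x (S j).
Proof. unfold binary_digit. do 2 f_equal. simpl. ring. Qed.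

Lemma frac_part_double (x : R) :
  frac_part (2 * x) = 2 * frac_part x - IZR (binary_digit x 1).
Proof.
  unfold frac_part, binary_digit. simpl pow. rewrite Rmult_1_r.
  pose proof (base_Int_part x) as [A B]. pose proof (base_Int_part (2 * x)) as [C D].
  pose proof (Z.div_mod (Int_part (2 * x)) 2 ltac:(lia)) as E.
  pose proof (Z.mod_pos_bound (Int_part (2 * x)) 2 ltac:(lia)) as F.
  set (d := (Int_part (2 * x) mod 2)%Z) in *.
  assert (G : (Int_part (2 * x) / 2)%Z = Int_part x).
  { assert (IZR (Int_part (2 * x)) < IZR (2 * Int_part x + 2))
      by (rewrite plus_IZR, mult_IZR; lra).
    assert (IZR (2 * Int_part x) < IZR (Int_part (2 * x) + 1))
      by (rewrite plus_IZR, mult_IZR; lra).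
    apply lt_IZR in H, H0. lia. }
  rewrite G in E. rewrite E, plus_IZR, mult_IZR. lra.
Qed.

Lemma dist_int_digit (x : R) :
  dist_int x = if (binary_digit x 1 =? 0)%Z then frac_part x else 1 - frac_part x.
Proof.
  pose proof (frac_part_double x) as E. pose proof (frac_part_bound (2 * x)).
  unfold dist_int. destruct (binary_digit_01 x 1) as [D | D]; rewrite D in *; simpl.
  - apply Rmin_left. lra.
  - apply Rmin_right. lra.
Qed.

Lemma is_series_binary_digit (x : R) :
  is_series (fun i => IZR (binary_digit x (S i)) / 2 ^ (S i)) (frac_part x).
Proof.
  assert (P : forall n, sum_n (fun i => IZR (binary_digit x (S i)) / 2 ^ (S i)) n
    = frac_part x - frac_part (2 ^ (S n) * x) * (/ 2) ^ (S n)).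
  { assert (S1 : forall n, IZR (binary_digit x (S n)) / 2 ^ (S n)
      = frac_part (2 ^ n * x) * (/ 2) ^ n - frac_part (2 ^ (S n) * x) * (/ 2) ^ (S n)).
    { intros n. replace (2 ^ S n * x) with (2 * (2 ^ n * x)) by (simpl; ring).
      rewrite frac_part_double.
      replace (binary_digit (2 ^ n * x) 1) with (binary_digit x (S n))
        by (unfold binary_digit; do 2 f_equal; simpl; ring).
      rewrite !pow_inv. simpl. field. apply pow_nonzero. lra. }
    induction n as [|n IH].
    - rewrite sum_O, S1. simpl. rewrite !Rmult_1_l. lra.
    - rewrite sum_Sn, IH, S1. unfold plus. simpl. lra. }
  match goal with |- is_series ?a ?l => change (is_lim_seq (sum_n a) (Finite l)) end.
  apply (is_lim_seq_ext (fun n => frac_part x - frac_part (2 ^ (S n) * x) * (/ 2) ^ (S n)));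
    [intros n; now rewrite P|].
  replace (Finite (frac_part x)) with (Finite (frac_part x - 0)) by (f_equal; lra).
  apply is_lim_seq_minus'; [apply is_lim_seq_const|].
  apply is_lim_seq_le_le with (u := fun _ => 0) (w := fun n => (/ 2) ^ (S n)).
  - intros n. pose proof (frac_part_bound (2 ^ (S n) * x)).
    assert (0 < (/ 2) ^ (S n)) by (apply pow_lt; lra). nra.
  - apply is_lim_seq_const.
  - apply (is_lim_seq_incr_1 (fun n => (/ 2) ^ n)), is_lim_seq_geom.
    rewrite Rabs_pos_eq; lra.
Qed.

Lemma digit_sum_bound (x : R) (i : nat) :
  0 <= sum_n_m (fun j => IZR (binary_digit x j)) 1 i <= INR i.
Proof.
  induction i as [|i IH].
  - rewrite sum_n_m_zero by lia. unfold zero. simpl. lra.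
  - rewrite sum_n_Sm by lia. unfold plus. rewrite S_INR. simpl.
    destruct (binary_digit_01 x (S i)) as [D | D]; rewrite D; lra.
Qed.

Lemma takagi_ell_bound (x : R) (i : nat) : 0 <= takagi_ell x i <= INR i.
Proof.
  pose proof (digit_sum_bound x i). unfold takagi_ell. cbv zeta. destruct Z.eqb; lra.
Qed.

Lemma takagi_term_bound (x : R) (i : nat) :
  0 <= takagi_ell x i / 2 ^ (S i) <= (3 / 4) ^ i.
Proof.
  pose proof (takagi_ell_bound x i).
  assert (P : 0 < (/ 2) ^ i) by (apply pow_lt; lra).
  assert (B : INR i <= 2 * (3 / 2) ^ i).
  { assert (INR i / 2 + 1 <= (3 / 2) ^ i); [|lra]. clear.
    induction i as [|i IH]; [simpl; lra|].
    rewrite S_INR. simpl. pose proof (pos_INR i). lra. }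
  replace (takagi_ell x i / 2 ^ (S i)) with (takagi_ell x i / 2 * (/ 2) ^ i)
    by (rewrite pow_inv; simpl; field; apply pow_nonzero; lra).
  replace (3 / 4) with (3 / 2 * / 2) by lra. rewrite Rpow_mult_distr. split; nra.
Qed.

Lemma ex_series_takagi (x : R) : ex_series (fun i => takagi_ell x i / 2 ^ (S i)).
Proof.
  apply (ex_series_le (V := R_CompleteNormedModule)) with (b := fun i => (3 / 4) ^ i).
  - intros i. pose proof (takagi_term_bound x i). unfold norm. simpl.
    unfold abs. simpl. rewrite Rabs_pos_eq; [apply H | apply H].
  - apply ex_series_geom. rewrite Rabs_pos_eq; lra.
Qed.

Lemma takagi_bound (x : R) : 0 <= takagi x <= 4.
Proof.
  split.
  - rewrite <- Series_zero.
    apply Series_le; [|apply ex_series_takagi].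
    intros i. split; [lra | apply takagi_term_bound].
  - replace 4 with (Series (fun i => (3 / 4) ^ i))
      by (rewrite Series_geom; [lra | rewrite Rabs_pos_eq; lra]).
    apply Series_le; [apply takagi_term_bound|].
    apply ex_series_geom. rewrite Rabs_pos_eq; lra.
Qed.

Lemma takagi_ell_double (x : R) (i : nat) :
  takagi_ell x (S i) = takagi_ell (2 * x) i
    + (if (binary_digit x 1 =? 0)%Z then IZR (binary_digit (2 * x) (S i))
       else 1 - IZR (binary_digit (2 * x) (S i))).
Proof.
  unfold takagi_ell. cbv zeta. rewrite <- binary_digit_double.
  rewrite sum_Sn_m by lia. rewrite <- sum_n_m_S.
  rewrite (sum_n_m_ext _ (fun j => IZR (binary_digit (2 * x) j)))
    by (intros j; now rewrite binary_digit_double).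
  set (s := sum_n_m _ 1 i). change plus with Rplus. rewrite S_INR.
  destruct (binary_digit_01 x 1) as [D | D]; rewrite D;
    destruct (binary_digit_01 (2 * x) (S i)) as [E | E]; rewrite E; simpl; lra.
Qed.

Lemma takagi_double (x : R) : takagi x = dist_int x + / 2 * takagi (2 * x).
Proof.
  unfold takagi at 1. rewrite Series_incr_1 by apply ex_series_takagi.
  replace (takagi_ell x 0) with 0
    by (pose proof (takagi_ell_bound x 0) as B; simpl in B; lra).
  unfold Rdiv at 1. rewrite Rmult_0_l, Rplus_0_l.
  assert (G : is_series (fun i => (if (binary_digit x 1 =? 0)%Z
      then IZR (binary_digit (2 * x) (S i))
      else 1 - IZR (binary_digit (2 * x) (S i))) / 2 ^ (S (S i))) (dist_int x)).
  { pose proof (is_series_binary_digit (2 * x)) as D.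
    pose proof (frac_part_double x) as F. rewrite dist_int_digit.
    destruct (binary_digit_01 x 1) as [E | E]; rewrite E in *; simpl Z.eqb; cbv iota.
    - apply (is_series_scal (/ 2)) in D.
      replace (frac_part x) with (scal (/ 2) (frac_part (2 * x)))
        by (unfold scal; simpl; unfold mult; simpl; lra).
      eapply is_series_ext; [|exact D]. intros i. unfold scal. simpl.
      unfold mult. simpl. field. apply pow_nonzero. lra.
    - assert (Q : is_series (fun i => (/ 2) ^ i) (/ (1 - / 2)))
        by (apply is_series_geom; rewrite Rabs_pos_eq; lra).
      apply (is_series_scal (/ 4)) in Q. apply (is_series_scal (- / 2)) in D.
      pose proof (is_series_plus _ _ _ _ Q D) as P.
      replace (1 - frac_part x)
        with (plus (scal (/ 4) (/ (1 - / 2))) (scal (- / 2) (frac_part (2 * x))))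
        by (unfold plus, scal; simpl; unfold mult; simpl; lra).
      eapply is_series_ext; [|exact P]. intros i. unfold plus, scal. simpl.
      unfold mult. simpl. rewrite pow_inv. field. apply pow_nonzero. lra. }
  rewrite <- (is_series_unique _ _ G). unfold takagi. rewrite <- Series_scal_l.
  rewrite <- Series_plus.
  - apply Series_ext. intros i. rewrite takagi_ell_double. simpl. field.
    apply pow_nonzero. lra.
  - eexists. exact G.
  - apply (ex_series_scal (/ 2) (fun i => takagi_ell (2 * x) i / 2 ^ S i)).
    apply ex_series_takagi.
Qed.

Lemma takagi_dist (x : R) :
  takagi x = Series (fun m => (/ 2) ^ m * dist_int (2 ^ m * x)).
Proof.
  assert (P : forall n, sum_n (fun m => (/ 2) ^ m * dist_int (2 ^ m * x)) n
    = takagi x - (/ 2) ^ (S n) * takagi (2 ^ (S n) * x)).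
  { assert (S1 : forall n, (/ 2) ^ n * dist_int (2 ^ n * x)
      = (/ 2) ^ n * takagi (2 ^ n * x) - (/ 2) ^ (S n) * takagi (2 ^ (S n) * x)).
    { intros n. rewrite (takagi_double (2 ^ n * x)).
      replace (2 ^ S n * x) with (2 * (2 ^ n * x)) by (simpl; ring). simpl. ring. }
    induction n as [|n IH].
    - rewrite sum_O, S1. simpl. rewrite !Rmult_1_l. lra.
    - rewrite sum_Sn, IH, S1. unfold plus. simpl. lra. }
  symmetry. apply is_series_unique.
  match goal with |- is_series ?a ?l => change (is_lim_seq (sum_n a) (Finite l)) end.
  apply (is_lim_seq_ext (fun n => takagi x - (/ 2) ^ (S n) * takagi (2 ^ (S n) * x)));
    [intros n; now rewrite P|].
  replace (Finite (takagi x)) with (Finite (takagi x - 0)) by (f_equal; lra).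
  apply is_lim_seq_minus'; [apply is_lim_seq_const|].
  apply is_lim_seq_le_le with (u := fun _ => 0) (w := fun n => 4 * (/ 2) ^ (S n)).
  - intros n. pose proof (takagi_bound (2 ^ (S n) * x)).
    assert (0 < (/ 2) ^ (S n)) by (apply pow_lt; lra). nra.
  - apply is_lim_seq_const.
  - replace (Finite 0) with (Rbar_mult (Finite 4) (Finite 0))
      by (simpl; f_equal; ring).
    apply is_lim_seq_scal_l.
    apply (is_lim_seq_incr_1 (fun n => (/ 2) ^ n)), is_lim_seq_geom.
    rewrite Rabs_pos_eq; lra.
Qed.

(* Main.v *)
Require Import Defs.
From Stdlib Require Import Reals ZArith.
From Stdlib Require Import Lra Lia List.
From Coquelicot Require Import Coquelicot.
Open Scope R_scope.

(** Each summand of [takagi x = sum_m 2^-m * dist_int (2^m * x)] is affine of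
    slope [1] or [-1] between consecutive multiples of [2^-(m+1)], the slope
    being [1] where the binary digit of index [m + 1] is [0] and [-1] where it
    is [1]. From [r / 2^k] to [(r + 1) / 2^k] the first [k] summands therefore
    change by [2^-k] for each [0] and by [- 2^-k] for each [1] among the [k] low
    binary digits of [r], and the other summands vanish at both ends. So

      [2^k * (takagi (r / 2^k) - takagi ((r + 1) / 2^k))]

    is the number of ones minus the number of zeros among these digits, that is,
    twice the number of ones minus [k] ([takagi_increment]). Half of it, plus
    [k / 2], counts the ones; the leading digit of [2^k + r] adds one more
    ([hamming_weight_leading_bit]).

    The increment is computed by induction on [k] with the functional equation
    [takagi_double]. Doubling takes [r / 2^(k+1)] to [r / 2^k] with the same
    [r], so it is convenient to allow every natural [r], not only [r < 2^k]:
    the induction then never has to reduce [r] modulo [2^k]. *)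

Definition low_weight (k r : nat) : nat :=
  length (filter (Nat.testbit r) (seq 0 k)).

Lemma low_weight_S (k r : nat) :
  low_weight (S k) r = (low_weight k r + Nat.b2n (Nat.testbit r k))%nat.
Proof.
  unfold low_weight. rewrite seq_S, filter_app, length_app. simpl.
  now destruct (Nat.testbit r k).
Qed.

Lemma low_weight_mod (k n : nat) : low_weight k (n mod 2 ^ k) = low_weight k n.
Proof.
  unfold low_weight. f_equal. apply filter_ext_in. intros i Hi.
  apply in_seq in Hi. apply Nat.mod_pow2_bits_low. lia.
Qed.

Lemma low_weight_above (k n d : nat) :
  (n < 2 ^ k)%nat -> low_weight (k + d) n = low_weight k n.
Proof.
  intros Hn. induction d as [|d IH].
  - now rewrite Nat.add_0_r.
  - rewrite Nat.add_succ_r, low_weight_S, IH.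
    rewrite <- (Nat.mod_small n (2 ^ k)) at 2 by assumption.
    rewrite Nat.mod_pow2_bits_high by lia. simpl. lia.
Qed.

Lemma hamming_weight_leading_bit (k r : nat) :
  (r < 2 ^ k)%nat -> hamming_weight (2 ^ k + r) = S (low_weight k r).
Proof.
  intros Hr. set (n := (2 ^ k + r)%nat).
  assert (Hk : (k < 2 ^ k)%nat) by (apply Nat.pow_gt_lin_r; lia).
  assert (Hmod : (n mod 2 ^ k)%nat = r).
  { unfold n. replace (2 ^ k + r)%nat with (r + 1 * 2 ^ k)%nat by lia.
    rewrite Nat.Div0.mod_add. now apply Nat.mod_small. }
  assert (Htop : Nat.testbit n k = true).
  { rewrite <- (Nat.log2_unique n k) by (unfold n; simpl; lia).
    apply Nat.bit_log2. unfold n. lia. }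
  change (hamming_weight n) with (low_weight n n).
  replace (low_weight n n) with (low_weight (S k + (n - S k)) n)
    by (f_equal; unfold n; lia).
  rewrite low_weight_above by (unfold n; simpl; lia).
  rewrite low_weight_S, Htop, <- low_weight_mod, Hmod. simpl. lia.
Qed.

(** Both ends of the half-unit interval are included, because the right-hand
    point [(r + 1) / 2^(k+1)] of the increment below may be its right end. There
    [binary_digit] already gives the digit of the next interval, so
    [dist_int_digit] alone does not suffice. *)
Lemma dist_int_half_unit (q : Z) (b : bool) (x : R) :
  IZR q + INR (Nat.b2n b) / 2 <= x <= IZR q + (INR (Nat.b2n b) + 1) / 2 ->
  dist_int x = if b then IZR q + 1 - x else x - IZR q.
Proof.
  intros H. unfold dist_int, frac_part. destruct b; simpl in H.
  - destruct (Rlt_le_dec x (IZR q + 1)) as [L | L].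
    + rewrite (Int_part_unique x q) by lra. rewrite Rmin_right; lra.
    + rewrite (Int_part_unique x (q + 1)) by (rewrite plus_IZR; lra).
      rewrite plus_IZR, Rmin_left; lra.
  - rewrite (Int_part_unique x q) by lra. rewrite Rmin_left; lra.
Qed.

Lemma dist_int_increment (k r : nat) :
  2 ^ S k * (dist_int (INR r / 2 ^ S k) - dist_int ((INR r + 1) / 2 ^ S k))
  = 2 * INR (Nat.b2n (Nat.testbit r k)) - 1.
Proof.
  set (b := Nat.testbit r k).
  set (q := (r / 2 ^ k / 2)%nat). set (s := (r mod 2 ^ k)%nat).
  assert (Hs : (s < 2 ^ k)%nat) by (apply Nat.mod_upper_bound, Nat.pow_nonzero; lia).
  assert (Hr : (r = 2 ^ k * (2 * q + Nat.b2n b) + s)%nat).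
  { unfold b, q, s. rewrite Nat.testbit_spec', <- Nat.div_mod_eq.
    apply Nat.div_mod_eq. }
  assert (P : 0 < 2 ^ k) by (apply pow_lt; lra).
  assert (Hs' : 0 <= INR s /\ INR s + 1 <= 2 ^ k).
  { split; [apply pos_INR|].
    apply le_INR in Hs. rewrite S_INR, pow_INR in Hs. exact Hs. }
  assert (Hr' : INR r = 2 ^ k * (2 * INR q + INR (Nat.b2n b)) + INR s).
  { rewrite Hr at 1. rewrite plus_INR, mult_INR, plus_INR, mult_INR, pow_INR.
    reflexivity. }
  (* The two end points are [t = s] and [t = s + 1]; both lie in the same
     half-unit interval. *)
  assert (D : forall t, 0 <= t <= 2 ^ k ->
    dist_int ((INR r - INR s + t) / 2 ^ S k)
    = if b then INR q + 1 - (INR r - INR s + t) / 2 ^ S k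
      else (INR r - INR s + t) / 2 ^ S k - INR q).
  { intros t Ht. rewrite !(INR_IZR_INZ q). apply dist_int_half_unit.
    rewrite <- INR_IZR_INZ.
    replace ((INR r - INR s + t) / 2 ^ S k)
      with (INR q + INR (Nat.b2n b) / 2 + t / 2 ^ k / 2)
      by (rewrite Hr'; simpl; field; lra).
    assert (0 <= t / 2 ^ k <= 1).
    { split; [apply Rle_div_r | apply Rle_div_l]; lra. }
    lra. }
  replace (INR r / 2 ^ S k) with ((INR r - INR s + INR s) / 2 ^ S k)
    by (f_equal; ring).
  replace ((INR r + 1) / 2 ^ S k) with ((INR r - INR s + (INR s + 1)) / 2 ^ S k)
    by (f_equal; ring).
  rewrite !D by lra.
  destruct b; simpl; field; lra.
Qed.

Lemma dist_int_INR (m : nat) : dist_int (INR m) = 0.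
Proof.
  rewrite INR_IZR_INZ, (dist_int_half_unit (Z.of_nat m) false); simpl; lra.
Qed.

Lemma takagi_INR (m : nat) : takagi (INR m) = 0.
Proof.
  rewrite takagi_dist, <- Series_zero. apply Series_ext. intros i.
  replace (2 ^ i * INR m) with (INR (2 ^ i * m))
    by (rewrite mult_INR, pow_INR; reflexivity).
  rewrite dist_int_INR. ring.
Qed.

(** By [takagi_double], passing from [k] to [k + 1] adds the increment of
    [dist_int], which is the contribution of the binary digit of [r] of
    index [k]. *)
Lemma takagi_increment (k r : nat) :
  2 ^ k * (takagi (INR r / 2 ^ k) - takagi ((INR r + 1) / 2 ^ k))
  = 2 * INR (low_weight k r) - INR k.
Proof.
  induction k as [|k IH].
  - simpl. rewrite !Rdiv_1_r, <- S_INR, !takagi_INR. simpl. lra.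
  - assert (P : 2 ^ k <> 0) by (apply pow_nonzero; lra).
    rewrite (takagi_double (INR r / 2 ^ S k)), (takagi_double ((INR r + 1) / 2 ^ S k)).
    replace (2 * (INR r / 2 ^ S k)) with (INR r / 2 ^ k)
      by (simpl; field; exact P).
    replace (2 * ((INR r + 1) / 2 ^ S k)) with ((INR r + 1) / 2 ^ k)
      by (simpl; field; exact P).
    pose proof (dist_int_increment k r) as D.
    rewrite low_weight_S, plus_INR, S_INR.
    change (2 ^ S k) with (2 * 2 ^ k) in *. lra.
Qed.

Theorem theorem28 (n k r : nat) (Hr : (r < 2 ^ k)%nat) (Hn : n = (2 ^ k + r)%nat) :
  INR (hamming_weight n) =
    powerRZ 2 (Z.of_nat k - 1)
      * (takagi (INR r / 2 ^ k) - takagi ((INR r + 1) / 2 ^ k))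
    + (INR k + 2) / 2.
Proof.
  rewrite Hn, hamming_weight_leading_bit, S_INR by assumption.
  replace (powerRZ 2 (Z.of_nat k - 1)) with (2 ^ k / 2).
  - pose proof (takagi_increment k r). lra.
  - unfold Z.sub. rewrite powerRZ_add, <- pow_powerRZ by lra. simpl. lra.
Qed.
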